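(* Let $a>0$ and $0\le c\le 2/3$, and let $f_c(z)=-az+acz^3$ for $z\in D$, with flow $\phi_t$. Then the system $\dot z=f_c(z)$ is intrinsically contracting on all of $D$ with rate exactly $a$, and $$d_K(\phi_t(x),\phi_t(y))\le e^{-at}\,d_K(x,y)\qquad\text{for all }x,y\in D,\ t\ge0$$ (with no multiplicative constant and no restriction to a proper sub-disc).
   Context: $D=\{\zeta\in\mathbb{C}:|\zeta|<1\}$. The Kobayashi (Poincaré) metric on $D$ is $F_K(z,v)=|v|/(1-|z|^2)$ for $z\in D$, $v\in\mathbb{C}$, and $d_K(x,y)=\inf_\gamma\int_0^1F_K(\gamma(s),\dot\gamma(s))\,ds$, the infimum being over piecewise smooth curves $\gamma:[0,1]\to D$ joining $x$ and $y$. $\phi_t:D\to D$, $t\ge0$, is the flow of $\dot z=f_c(z)$: $t\mapsto\phi_t(z)$ is the solution starting at $z$. (Here $f_c(z)=-z\,p_c(z)$ with $p_c(z)=a(1-cz^2)$, $\mathrm{Re}(p_c)\ge0$ on $D$, so by the Berkson–Porta theorem $f_c$ generates a semiflow of holomorphic self-maps of $D$ defined for all $t\ge0$.) For a trajectory $z(t)=\phi_t(z_0)$, an infinitesimal variation along it is $\delta z(t)=\phi_t'(z_0)v$, $v\in\mathbb{C}$, which solves $\dot{\delta z}=f_c'(z(t))\,\delta z$. The upper Dini derivative is $D^+g(t)=\limsup_{\epsilon\to0^+}(g(t+\epsilon)-g(t))/\epsilon$. The system is intrinsically contracting with rate $\lambda>0$ if $D^+F_K(z(t),\delta z(t))\le-\lambda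 F_K(z(t),\delta z(t))$ for all $t\ge0$ along every trajectory and every infinitesimal variation. *)

(* Defs.v *)
From Stdlib Require Import Reals.
From Coquelicot Require Import Coquelicot.
Open Scope R_scope.

Definition unit_disc (z : C) : Prop := Cmod z < 1.

Definition F_K (z v : C) : R := Cmod v / (1 - Cmod z ^ 2).

(* [Derive] is total; its value at the break points of a piecewise smooth
   curve is irrelevant to the Riemann integral below. *)
Definition velocity (gamma : R -> C) (s : R) : C :=
  (Derive (fun u => fst (gamma u)) s, Derive (fun u => snd (gamma u)) s).

(* C^1 up to the end points: the derivative on the open interval extends
   continuously to the closed one.  Continuity of [gamma] itself at the end
   points is part of [piecewise_smooth]. *)
Definition smooth_piece (gamma : R -> C) (u w : R) : Prop :=
  exists g : R -> C,
    continuous_on (fun s => u <= s <= w) g /\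
    forall s, u < s < w ->
      is_derive (K := R_AbsRing) (V := C_R_NormedModule) gamma s (g s).

(* Curves are total functions on R of which only the restriction to [0,1]
   matters. *)
Definition piecewise_smooth (gamma : R -> C) : Prop :=
  continuous_on (fun s => 0 <= s <= 1) gamma /\
  exists (n : nat) (sigma : nat -> R),
    sigma 0%nat = 0 /\ sigma n = 1 /\
    (forall i, (i < n)%nat -> sigma i < sigma (S i)) /\
    (forall i, (i < n)%nat -> smooth_piece gamma (sigma i) (sigma (S i))).

Definition curve_in_disc (x y : C) (gamma : R -> C) : Prop :=
  piecewise_smooth gamma /\
  (forall s, 0 <= s <= 1 -> unit_disc (gamma s)) /\
  gamma 0 = x /\ gamma 1 = y.

Definition K_length (gamma : R -> C) : R :=
  RInt (fun s => F_K (gamma s) (velocity gamma s)) 0 1.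

(* For [x], [y] in the disc the set of lengths is nonempty (segments) and
   bounded below by 0, so the infimum is finite and [real] loses nothing. *)
Definition d_K (x y : C) : R :=
  real (Glb_Rbar
    (fun L => exists gamma, curve_in_disc x y gamma /\ L = K_length gamma)).

Definition f_c (a c : R) (z : C) : C :=
  (- (RtoC a * z) + RtoC a * RtoC c * z ^ 3)%C.

(* [phi t z] is the value at time [t] of the solution of z' = f z starting at
   [z]; nothing is said for t < 0 or [z] outside the disc.  The derivative in
   time is taken within [0, +oo), hence one-sided at t = 0. *)
Definition is_semiflow (f : C -> C) (phi : R -> C -> C) : Prop :=
  forall z, unit_disc z ->
    phi 0 z = z /\
    forall t, 0 <= t ->
      unit_disc (phi t z) /\
      filterdiff (K := R_AbsRing) (U := R_NormedModule) (V := C_R_NormedModule)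
        (fun s => phi s z) (within (fun s => 0 <= s) (locally t))
        (fun h => scal h (f (phi t z))).

(* [C_derive] is total and agrees with the complex derivative wherever the
   latter exists ([is_C_derive_unique]); time-t maps of the flow are
   holomorphic on the disc. *)
Definition variation (phi : R -> C -> C) (z0 v : C) (t : R) : C :=
  (C_derive (phi t) z0 * v)%C.

(* limsup as eps -> 0+, written inf_{delta > 0} sup_{0 < eps < delta}, with
   values in the extended reals. *)
Definition Dini_upper (g : R -> R) (t : R) : Rbar :=
  Rbar_glb (fun y => exists delta, 0 < delta /\
    y = Lub_Rbar (fun q => exists eps, 0 < eps < delta /\
                           q = (g (t + eps) - g t) / eps)).

Definition intrinsically_contracting (phi : R -> C -> C) (lambda : R) : Prop :=
  0 < lambda /\
  forall z0 v : C, unit_disc z0 ->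
    let g := fun t => F_K (phi t z0) (variation phi z0 v t) in
    forall t, 0 <= t -> Rbar_le (Dini_upper g t) (Finite (- lambda * g t)).

(* Main.v *)
Require Import Defs.
From Stdlib Require Import Reals Lra Psatz Lia.
From Coquelicot Require Import Coquelicot.
Open Scope R_scope.

(** The equation z' = - a z + a c z^3 is of Bernoulli type and is solved in
    closed form.  With q = exp (- a t) and m = 1 - c (1 - q^2) z^2, the time-t
    map is

      flow c q z = z q / sqrt m,   with complex derivative  q / (sqrt m)^3,

    where sqrt is the principal branch: |1 - m| <= 2/3 keeps m in the right
    half-plane.  That every semiflow is given by this formula
    ([semiflow_explicit]) follows from the one-sided Lipschitz bound
    [one_sided_lipschitz] and a Gronwall argument.

    Put b = |sqrt m|.  The Kobayashi norm of the image of a tangent vector v is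

      F_K = q |v| / (b (b^2 - |z|^2 q^2)),

    so contraction by the factor q means that b (b^2 - |z|^2 q^2) does not
    decrease in time.  As q^2 drops by d, the triangle inequality allows
    b^2 = |m| to drop by at most c |z|^2 d <= (2/3) |z|^2 d, and 2/3 is just
    what the elementary inequality [cubic_gap_le] tolerates
    ([F_K_flow_contracts]).

    The Dini inequality is read off from
    F_K (t + e) <= exp (- a e) F_K (t).  The rate cannot exceed a, because at
    the fixed point 0 one has F_K (t) = exp (- a t) |v| exactly.  Finally, the
    time-t map sends a curve from x to y to a curve from phi_t x to phi_t y
    whose length is at most exp (- a t) times the original one
    ([K_length_flow]); passing to the infimum gives the bound on d_K. *)

Local Notation is_complex_derive := (@is_derive C_AbsRing C_NormedModule).
Local Notation is_curve_derive := (@is_derive R_AbsRing C_R_NormedModule).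

(** * Derivatives of complex functions and of plane curves *)

Lemma complex_derive_iff (f : C -> C) (z l : C) :
  is_complex_derive f z l <->
  forall eps : posreal, exists delta : posreal, forall w, Cmod (w - z) < delta ->
    Cmod (f w - f z - (w - z) * l) <= eps * Cmod (w - z).
Proof.
split.
- intros [_ H] eps.
  destruct (H z (fun P HP => HP) eps) as [d Hd].
  exists d. intros w Hw. exact (Hd w Hw).
- intros H. split; [apply is_linear_scal_l |].
  intros x Hx eps.
  assert (E : z = x).
  { apply (is_filter_lim_locally_unique (K := C_AbsRing)
      (V := AbsRing_NormedModule C_AbsRing)). exact Hx. }
  rewrite <- E. destruct (H eps) as [d Hd].
  exists d. intros w Hw. exact (Hd w Hw).
Qed.

(** The field C is a normed module over itself in two ways, with the same norm but
with different uniform structures.  The rules for products and compositions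
use one of them and the complex derivative the other. *)
Lemma complex_derive_absring (f : C -> C) (z l : C) :
  is_derive (K := C_AbsRing) (V := AbsRing_NormedModule C_AbsRing) f z l <->
  is_complex_derive f z l.
Proof. split; intros [_ H]; (split; [apply is_linear_scal_l | exact H]). Qed.

Lemma C_R_norm (z : C) : norm (K := R_AbsRing) (V := C_R_NormedModule) z = Cmod z.
Proof. symmetry. exact (Cmod_norm z). Qed.

Lemma curve_remainder (x y l : C) (h : R) :
  minus (minus x y) (scal (K := R_AbsRing) (V := C_R_NormedModule) h l) =
  (x - y - RtoC h * l)%C.
Proof.
destruct x, y, l. apply injective_projections; simpl;
  unfold minus, plus, opp, scal, mult; simpl; unfold mult; simpl; ring.
Qed.

Lemma curve_derive_iff (g : R -> C) (s : R) (l : C) :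
  is_curve_derive g s l <->
  forall eps : posreal, exists delta : posreal, forall u, Rabs (u - s) < delta ->
    Cmod (g u - g s - RtoC (u - s) * l) <= eps * Rabs (u - s).
Proof.
split.
- intros [_ H] eps.
  destruct (H s (fun P HP => HP) eps) as [d Hd].
  exists d. intros u Hu. rewrite <- curve_remainder, <- C_R_norm. exact (Hd u Hu).
- intros H. split; [apply is_linear_scal_l |].
  intros x Hx eps.
  assert (Ex : s = x)
    by (apply (is_filter_lim_locally_unique (K := R_AbsRing) (V := R_NormedModule)); exact Hx).
  rewrite <- Ex. destruct (H eps) as [d Hd].
  exists d. intros u Hu. specialize (Hd u Hu).
  rewrite <- curve_remainder, <- C_R_norm in Hd. exact Hd.
Qed.

(** All elementary complex derivatives below have an explicit remainder of second
order, which this criterion turns into differentiability. *)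
Lemma quadratic_remainder_derive (f : C -> C) (z l : C) (r M : R) :
  0 < r -> 0 <= M ->
  (forall w, Cmod (w - z) < r ->
     Cmod (f w - f z - (w - z) * l) <= M * Cmod (w - z) ^ 2) ->
  is_complex_derive f z l.
Proof.
intros Hr HM H. apply complex_derive_iff. intros eps.
assert (Hd : 0 < Rmin r (eps / (M + 1))).
{ apply Rmin_pos; [exact Hr |]. apply Rdiv_lt_0_compat; [apply cond_pos | lra]. }
exists (mkposreal _ Hd). intros w Hw. simpl in Hw.
assert (Hw1 := Rlt_le_trans _ _ _ Hw (Rmin_l _ _)).
assert (Hw2 := Rlt_le_trans _ _ _ Hw (Rmin_r _ _)).
apply Rle_trans with (1 := H w Hw1).
assert (P := Cmod_ge_0 (w - z)%C).
assert (E := cond_pos eps).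
apply (Rmult_lt_compat_r (M + 1)) in Hw2; [| lra].
replace (eps / (M + 1) * (M + 1)) with (eps : R) in Hw2 by (field; lra).
nra.
Qed.

Lemma Cmod_le_sub_add (w z : C) : Cmod w <= Cmod (w - z) + Cmod z.
Proof. replace w with (w - z + z)%C at 1 by ring. apply Cmod_triangle. Qed.

Lemma Cinv_derive (z : C) : z <> RtoC 0 ->
  is_complex_derive Cinv z (- / (z * z))%C.
Proof.
intros Hz. assert (P := proj1 (Cmod_gt_0 z) Hz).
apply (quadratic_remainder_derive _ _ _ (Cmod z / 2) (2 / Cmod z ^ 3)).
- lra.
- apply Rlt_le, Rdiv_lt_0_compat; [lra | apply pow_lt, P].
- intros w Hw.
  assert (Hw0 : Cmod z / 2 <= Cmod w).
  { assert (T := Cmod_le_sub_add z w).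
    replace (z - w)%C with (- (w - z))%C in T by ring. rewrite Cmod_opp in T. lra. }
  assert (w <> RtoC 0) by (apply Cmod_gt_0; lra).
  replace (/ w - / z - (w - z) * - / (z * z))%C
    with ((w - z) ^ 2 * / (z * z * w))%C by (field; auto).
  rewrite Cmod_mult, Cmod_pow, Cmod_inv by (repeat apply Cmult_neq_0; auto).
  rewrite !Cmod_mult, Rmult_comm. apply Rmult_le_compat_r; [apply pow2_ge_0 |].
  replace (2 / Cmod z ^ 3) with (/ (Cmod z * Cmod z * (Cmod z / 2))) by (field; lra).
  apply Rinv_le_contravar; [apply Rmult_lt_0_compat; nra |].
  apply Rmult_le_compat_l; nra.
Qed.

Lemma Cderive_scal_id (k z : C) :
  is_complex_derive (fun w => k * w)%C z k.
Proof.
apply (quadratic_remainder_derive _ _ _ 1 0); [lra | lra |].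
intros w _. replace (k * w - k * z - (w - z) * k)%C with (RtoC 0) by ring. rewrite Cmod_0. lra.
Qed.

Lemma Cderive_mult (f g : C -> C) (z df dg : C) :
  is_complex_derive f z df ->
  is_complex_derive g z dg ->
  is_complex_derive
    (fun w => f w * g w)%C z (df * g z + f z * dg)%C.
Proof.
intros Hf Hg. apply complex_derive_absring.
apply (is_derive_mult (K := C_AbsRing)); [| | exact Cmult_comm];
  apply complex_derive_absring; assumption.
Qed.

Lemma Cderive_comp (f h : C -> C) (z lf lh : C) :
  is_complex_derive f (h z) lf ->
  is_complex_derive h z lh ->
  is_complex_derive (fun w => f (h w)) z (lh * lf)%C.
Proof.
intros Hf Hh. apply complex_derive_absring in Hh.
exact (is_derive_comp (K := C_AbsRing) (V := C_NormedModule) f h z _ _ Hf Hh).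
Qed.

(** The chain rule mixes the two scalar fields: the outer function is complex
differentiable, the inner one is a curve with a real parameter. *)
Lemma derive_along_curve (f : C -> C) (g : R -> C) (s : R) (l dg : C) :
  is_complex_derive f (g s) l ->
  is_curve_derive g s dg ->
  is_curve_derive (fun u => f (g u)) s (dg * l)%C.
Proof.
intros Hf Hg. apply curve_derive_iff. intros eps.
rewrite complex_derive_iff in Hf. rewrite curve_derive_iff in Hg.
assert (Pd := Cmod_ge_0 dg). assert (Pl := Cmod_ge_0 l). assert (E := cond_pos eps).
assert (He1 : 0 < eps / (2 * (Cmod dg + 1))) by (apply Rdiv_lt_0_compat; lra).
destruct (Hf (mkposreal _ He1)) as [d1 Hd1]. simpl in Hd1.
assert (He2 : 0 < Rmin 1 (eps / (2 * (Cmod l + 1))))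
  by (apply Rmin_pos; [lra | apply Rdiv_lt_0_compat; lra]).
destruct (Hg (mkposreal _ He2)) as [d2 Hd2]. simpl in Hd2.
assert (Hd : 0 < Rmin d2 (d1 / (Cmod dg + 1))).
{ apply Rmin_pos; [apply cond_pos | apply Rdiv_lt_0_compat; [apply cond_pos | lra]]. }
exists (mkposreal _ Hd). intros u Hu. simpl in Hu.
assert (Hu1 := Rlt_le_trans _ _ _ Hu (Rmin_l _ _)).
assert (Hu2 := Rlt_le_trans _ _ _ Hu (Rmin_r _ _)).
specialize (Hd2 u Hu1).
assert (Pu := Rabs_pos (u - s)).
assert (B1 : Cmod (g u - g s - RtoC (u - s) * dg) <= 1 * Rabs (u - s)).
{ apply Rle_trans with (1 := Hd2). apply Rmult_le_compat_r; [exact Pu | apply Rmin_l]. }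
assert (B2 : Cmod (g u - g s - RtoC (u - s) * dg) <= eps / (2 * (Cmod l + 1)) * Rabs (u - s)).
{ apply Rle_trans with (1 := Hd2). apply Rmult_le_compat_r; [exact Pu | apply Rmin_r]. }
assert (L : Cmod (g u - g s) <= (Cmod dg + 1) * Rabs (u - s)).
{ replace (g u - g s)%C with ((g u - g s - RtoC (u - s) * dg) + RtoC (u - s) * dg)%C by ring.
  apply Rle_trans with (1 := Cmod_triangle _ _). rewrite Cmod_mult, Cmod_R. lra. }
assert (Hgu : Cmod (g u - g s) < d1).
{ apply Rle_lt_trans with (1 := L).
  apply (Rmult_lt_compat_l (Cmod dg + 1)) in Hu2; [| lra].
  replace ((Cmod dg + 1) * (d1 / (Cmod dg + 1))) with (d1 : R) in Hu2 by (field; lra). exact Hu2. }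
specialize (Hd1 _ Hgu).
replace (f (g u) - f (g s) - RtoC (u - s) * (dg * l))%C
  with ((f (g u) - f (g s) - (g u - g s) * l) + (g u - g s - RtoC (u - s) * dg) * l)%C by ring.
apply Rle_trans with (1 := Cmod_triangle _ _). rewrite Cmod_mult.
replace (eps * Rabs (u - s)) with
  (eps / (2 * (Cmod dg + 1)) * ((Cmod dg + 1) * Rabs (u - s))
   + eps / (2 * (Cmod l + 1)) * Rabs (u - s) * (Cmod l + 1)) by (field; lra).
apply Rplus_le_compat.
- apply Rle_trans with (1 := Hd1). apply Rmult_le_compat_l; lra.
- apply Rle_trans with (eps / (2 * (Cmod l + 1)) * Rabs (u - s) * Cmod l).
  + apply Rmult_le_compat_r; lra.
  + apply Rmult_le_compat_l; [| lra]. apply Rmult_le_pos; [| exact Pu].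
    apply Rlt_le, Rdiv_lt_0_compat; lra.
Qed.

Lemma curve_derive_components (g : R -> C) (s : R) (l : C) :
  is_curve_derive g s l ->
  is_derive (fun u => fst (g u)) s (fst l) /\ is_derive (fun u => snd (g u)) s (snd l).
Proof.
intros H. split.
- apply (filterdiff_comp' (V := C_R_NormedModule) g fst s _ fst H).
  apply filterdiff_linear, (is_linear_fst (U := R_NormedModule) (V := R_NormedModule)).
- apply (filterdiff_comp' (V := C_R_NormedModule) g snd s _ snd H).
  apply filterdiff_linear, (is_linear_snd (U := R_NormedModule) (V := R_NormedModule)).
Qed.

Lemma RtoC_curve_derive (h : R -> R) (s l : R) :
  is_derive h s l ->
  is_curve_derive (fun u => RtoC (h u)) s (RtoC l).
Proof.
intros [_ H]. apply curve_derive_iff. intros eps.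
destruct (H s (fun P HP => HP) eps) as [d Hd].
exists d. intros u Hu. specialize (Hd u Hu).
rewrite <- RtoC_mult, <- !RtoC_minus, Cmod_R. exact Hd.
Qed.

(** * The principal square root *)

Lemma C2_neq_0 : RtoC 2 <> RtoC 0.
Proof. intros E. apply RtoC_inj in E. lra. Qed.

Definition root (w : C) : C :=
  let r := sqrt ((Cmod w + Re w) / 2) in (r, Im w / (2 * r)).

Lemma root_Re_ge0 (w : C) : 0 <= Re (root w).
Proof. apply sqrt_pos. Qed.

Lemma root_Re_pos (w : C) : 0 < Re w -> 0 < Re (root w).
Proof. intros H. simpl. apply sqrt_lt_R0. assert (P := Cmod_ge_0 w). lra. Qed.

Lemma root_neq_0 (w : C) : 0 < Re w -> root w <> RtoC 0.
Proof. intros H E. assert (P := root_Re_pos w H). rewrite E in P. simpl in P. lra. Qed.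

Lemma root_sqr (w : C) : 0 < Re w -> (root w * root w)%C = w.
Proof.
intros H. assert (P := root_Re_pos w H). assert (Q := Cmod_ge_0 w).
assert (A := Cmod2_alt w).
assert (S2 : Re (root w) * Re (root w) = (Cmod w + Re w) / 2).
{ simpl. apply sqrt_sqrt. lra. }
change (root w) with ((Re (root w), Im w / (2 * Re (root w))) : C).
set (r := Re (root w)) in *. clearbody r.
destruct w as [x y]. unfold Cmult; simpl in *. f_equal; [| field; lra].
replace (y / (2 * r) * (y / (2 * r))) with (y * y / (4 * (r * r))) by (field; lra).
rewrite S2.
replace (y * y) with ((Cmod (x, y) + x) * (Cmod (x, y) - x)) by nra.
field. lra.
Qed.

(** If s^2 = w, t^2 = u and Re s > 0, Re t >= 0, then |t + s| >= Re s.  Hence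
t - s = (u - w) / (t + s) is of order u - w, and the remainder of the linear
approximation is exactly - (t - s)^2 / (2 s). *)
Lemma root_derive (w : C) : 0 < Re w ->
  is_complex_derive root w (/ (2 * root w))%C.
Proof.
intros Hw. set (s := root w). assert (P : 0 < Re s) by apply (root_Re_pos w Hw).
assert (Ns : s <> RtoC 0) by apply (root_neq_0 w Hw).
apply (quadratic_remainder_derive _ _ _ (Re w) (/ (2 * Re s ^ 3))); [exact Hw | |].
{ apply Rlt_le, Rinv_0_lt_compat. assert (0 < Re s ^ 3) by (apply pow_lt, P). lra. }
intros u Hu.
assert (Hru : 0 < Re u).
{ assert (T := re_le_Cmod (u - w)). change (Re (u - w)) with (Re u - Re w) in T.
  assert (T' := Rle_abs (- (Re u - Re w))). rewrite Rabs_Ropp in T'. lra. }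
fold s. assert (Ps := root_Re_ge0 u). set (t := root u) in *.
assert (Et : u = (t * t)%C) by (symmetry; apply root_sqr, Hru).
assert (Es : w = (s * s)%C) by (symmetry; apply root_sqr, Hw).
clearbody s t.
replace (t - s - (u - w) * / (2 * s))%C with (- ((t - s) ^ 2 * / (2 * s)))%C
  by (rewrite Et, Es; field; auto).
rewrite Et, Es.
replace (t * t - s * s)%C with ((t - s) * (t + s))%C by ring.
assert (N2 := C2_neq_0).
rewrite Cmod_opp, !Cmod_mult, Cmod_pow, Cmod_inv, Cmod_mult, Cmod_R, Rabs_pos_eq
  by (try lra; apply Cmult_neq_0; auto).
assert (L : Re s <= Cmod (t + s)).
{ assert (T := re_le_Cmod (t + s)). change (Re (t + s)) with (Re t + Re s) in T.
  assert (T' := Rle_abs (Re t + Re s)). lra. }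
rewrite Rpow_mult_distr.
assert (D := pow2_ge_0 (Cmod (t - s))).
replace (/ (2 * Re s ^ 3) * (Cmod (t - s) ^ 2 * Cmod (t + s) ^ 2)) with
  (Cmod (t - s) ^ 2 * (Cmod (t + s) ^ 2 * / (2 * Re s ^ 3))) by ring.
apply Rmult_le_compat_l; [exact D |].
apply Rle_trans with (/ (2 * Re s)).
- assert (Q := re_le_Cmod s). rewrite Rabs_pos_eq in Q by lra.
  apply Rinv_le_contravar; lra.
- replace (/ (2 * Re s)) with (Re s ^ 2 * / (2 * Re s ^ 3)) by (field; lra).
  apply Rmult_le_compat_r.
  + apply Rlt_le, Rinv_0_lt_compat. assert (0 < Re s ^ 3) by (apply pow_lt, P). lra.
  + apply pow_incr. lra.
Qed.

Lemma Cderive_inv_root (h : C -> C) (z dh : C) :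
  0 < Re (h z) ->
  is_complex_derive h z dh ->
  is_complex_derive
    (fun w => / root (h w))%C z (- dh / (2 * root (h z) ^ 3))%C.
Proof.
intros Hz Hh. assert (N := root_neq_0 _ Hz). assert (N2 := C2_neq_0).
assert (D := Cderive_comp Cinv (fun w => root (h w)) _ _ _ (Cinv_derive _ N)
  (Cderive_comp root h z _ _ (root_derive _ Hz) Hh)).
replace (- dh / (2 * root (h z) ^ 3))%C
  with (dh * / (2 * root (h z)) * - / (root (h z) * root (h z)))%C by (field; auto).
exact D.
Qed.

Lemma Cmod_root_sqr (w : C) : 0 < Re w -> Cmod (root w) ^ 2 = Cmod w.
Proof.
intros H. rewrite <- Cmod_pow. apply f_equal. rewrite <- (root_sqr w H) at 2. ring.
Qed.

Lemma root_1 : root 1 = 1%C.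
Proof.
assert (E : sqrt ((Cmod 1 + 1) / 2) = 1).
{ rewrite Cmod_1. replace ((1 + 1) / 2) with 1 by field. apply sqrt_1. }
unfold root. simpl. rewrite E. apply injective_projections; simpl; field.
Qed.

(** * The explicit flow *)

Definition radicand (c : R) (q z : C) : C := (1 - RtoC c * (1 - q * q) * (z * z))%C.

(** Here q stands for exp (- a t).  It is a complex variable so that both partial
derivatives, in z and in q, are complex derivatives. *)
Definition flow (c : R) (q z : C) : C := (z * q * / root (radicand c q z))%C.

Definition flow_deriv (c : R) (q z : C) : C := (q / root (radicand c q z) ^ 3)%C.

Lemma radicand_derive_z (c : R) (q z : C) :
  is_complex_derive (radicand c q) z
    (- (2 * RtoC c * (1 - q * q) * z))%C.
Proof.
apply (quadratic_remainder_derive _ _ _ 1 (Cmod (RtoC c * (1 - q * q)))); [lra | apply Cmod_ge_0 |].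
intros w _. rewrite <- Cmod_pow, <- Cmod_mult, <- Cmod_opp. apply Req_le, f_equal.
unfold radicand. ring.
Qed.

Lemma radicand_derive_q (c : R) (q z : C) :
  is_complex_derive (fun p => radicand c p z) q
    (2 * RtoC c * q * (z * z))%C.
Proof.
apply (quadratic_remainder_derive _ _ _ 1 (Cmod (RtoC c * (z * z)))); [lra | apply Cmod_ge_0 |].
intros w _. rewrite <- Cmod_pow, <- Cmod_mult. apply Req_le, f_equal.
unfold radicand. ring.
Qed.

Lemma flow_derive_z (c : R) (q z : C) : 0 < Re (radicand c q z) ->
  is_complex_derive (flow c q) z
    (q / root (radicand c q z) ^ 3)%C.
Proof.
intros H.
assert (N := root_neq_0 _ H).
assert (N2 := C2_neq_0).
assert (D := Cderive_mult _ _ _ _ _ (Cderive_scal_id q z)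
  (Cderive_inv_root _ _ _ H (radicand_derive_z c q z))).
apply (is_derive_ext (V := C_NormedModule) (K := C_AbsRing)
  (fun w => q * w * / root (radicand c q w))%C).
{ intros w. change (q * w * / root (radicand c q w) = flow c q w)%C. unfold flow. ring. }
match type of D with is_derive _ _ ?l => replace (q / root (radicand c q z) ^ 3)%C with l end; [exact D |].
(* Over the common denominator s^3 the numerator contains s^2 = radicand. *)
set (s := root (radicand c q z)) in *.
replace (q * / s)%C with (q * (s * s) / s ^ 3)%C by (field; auto).
unfold s at 1 2. rewrite root_sqr by exact H. unfold radicand. field. auto.
Qed.

Lemma flow_derive_q (c : R) (q z : C) : 0 < Re (radicand c q z) ->
  is_complex_derive (fun p => flow c p z) q
    (z * (1 - RtoC c * (z * z)) / root (radicand c q z) ^ 3)%C.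
Proof.
intros H.
assert (N := root_neq_0 _ H).
assert (N2 := C2_neq_0).
assert (D := Cderive_mult _ _ _ _ _ (Cderive_scal_id z q)
  (Cderive_inv_root (fun p => radicand c p z) _ _ H (radicand_derive_q c q z))).
match type of D with is_derive _ _ ?l =>
  replace (z * (1 - RtoC c * (z * z)) / root (radicand c q z) ^ 3)%C with l end; [exact D |].
(* Over the common denominator s^3 the numerator contains s^2 = radicand. *)
set (s := root (radicand c q z)) in *.
replace (z * / s)%C with (z * (s * s) / s ^ 3)%C by (field; auto).
unfold s at 1 2. rewrite root_sqr by exact H. unfold radicand. field. auto.
Qed.

(** The bracket on the right is the derivative of the flow in q, and - a q is the
time derivative of q = exp (- a t); hence the flow solves z' = f_c z. *)
Lemma f_c_flow (a c : R) (q z : C) : 0 < Re (radicand c q z) ->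
  f_c a c (flow c q z) =
  (RtoC (- a) * q * (z * (1 - RtoC c * (z * z)) / root (radicand c q z) ^ 3))%C.
Proof.
intros H.
assert (N := root_neq_0 _ H).
unfold f_c, flow. rewrite RtoC_opp.
set (s := root (radicand c q z)) in *.
transitivity (RtoC (-a) * z * q * (s * s - RtoC c * (z * q) * (z * q)) / s ^ 3)%C.
{ rewrite RtoC_opp. field. auto. }
unfold s at 1 2. rewrite root_sqr by exact H. unfold radicand. rewrite RtoC_opp. field. auto.
Qed.

Lemma flow_deriv_derivable (c : R) (q z : C) : 0 < Re (radicand c q z) ->
  exists l, is_complex_derive (flow_deriv c q) z l.
Proof.
intros H.
assert (N : root (radicand c q z) <> RtoC 0) by (apply root_neq_0, H).
assert (D := Cderive_comp root _ _ _ _ (root_derive _ H) (radicand_derive_z c q z)).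
assert (D1 := is_derive_const (K := C_AbsRing) (V := C_NormedModule) (RtoC 1) z).
assert (D3 := Cderive_mult _ _ _ _ _ D (Cderive_mult _ _ _ _ _ D (Cderive_mult _ _ _ _ _ D D1))).
assert (N3 : (root (radicand c q z) * (root (radicand c q z) * (root (radicand c q z) * 1)))%C <> RtoC 0).
{ repeat apply Cmult_neq_0; auto. apply C1_nz. }
eexists. exact (Cderive_mult _ _ _ _ _ (is_derive_const (K := C_AbsRing) (V := C_NormedModule) q z)
   (Cderive_comp Cinv
     (fun w => root (radicand c q w) * (root (radicand c q w) * (root (radicand c q w) * 1)))%C
     _ _ _ (Cinv_derive _ N3) D3)).
Qed.

(** The radicand is affine in q^2 with slope c z^2. *)
Lemma Cmod_radicand_diff (c q1 q2 : R) (z : C) : 0 <= c -> 0 <= q2 <= q1 ->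
  Cmod (radicand c q1 z) <= Cmod (radicand c q2 z) + c * Cmod z ^ 2 * (q1 ^ 2 - q2 ^ 2).
Proof.
intros Hc Hq.
replace (radicand c q1 z) with (radicand c q2 z + RtoC (c * (q1 ^ 2 - q2 ^ 2)) * (z * z))%C.
- apply Rle_trans with (1 := Cmod_triangle _ _). apply Rplus_le_compat_l.
  rewrite !Cmod_mult, Cmod_R, Rabs_pos_eq; [| apply Rmult_le_pos; nra]. apply Req_le. ring.
- unfold radicand. rewrite RtoC_mult, RtoC_minus, !RtoC_pow. ring.
Qed.

Lemma radicand_Re_pos (c q : R) (z : C) :
  0 <= c <= 2 / 3 -> 0 <= q <= 1 -> unit_disc z -> 0 < Re (radicand c q z).
Proof.
intros Hc Hq Hz. unfold unit_disc in Hz. assert (P := Cmod_ge_0 z).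
replace (radicand c q z) with (1 - RtoC (c * (1 - q ^ 2)) * (z * z))%C
  by (unfold radicand; rewrite RtoC_mult, RtoC_minus, RtoC_pow; ring).
change (0 < 1 - Re (RtoC (c * (1 - q ^ 2)) * (z * z))%C).
assert (T := re_le_Cmod (RtoC (c * (1 - q ^ 2)) * (z * z))).
assert (T' := Rle_abs (Re (RtoC (c * (1 - q ^ 2)) * (z * z)))).
rewrite !Cmod_mult, Cmod_R, (Rabs_pos_eq (c * (1 - q ^ 2))) in T by (apply Rmult_le_pos; nra).
assert (c * (1 - q ^ 2) <= 2 / 3) by nra.
assert (0 <= c * (1 - q ^ 2)) by (apply Rmult_le_pos; nra).
assert (Cmod z * Cmod z <= 1) by nra. nra.
Qed.

Lemma radicand_at_1 (c : R) (z : C) : radicand c 1 z = 1%C.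
Proof. unfold radicand. ring. Qed.

Lemma flow_at_1 (c : R) (z : C) : flow c 1 z = z.
Proof. unfold flow. rewrite radicand_at_1, root_1. field. Qed.

Lemma flow_deriv_at_1 (c : R) (z : C) : flow_deriv c 1 z = 1%C.
Proof. unfold flow_deriv. rewrite radicand_at_1, root_1. field. Qed.

(** The left side increases and the lower bound on the right side, namely
1 - c |z|^2 (1 - q^2), increases at the slower rate c |z|^2; at q = 1 the inequality
reads |z|^2 < 1.  This says that the flow stays in the disc. *)
Lemma radicand_dominates (c q : R) (z : C) :
  0 <= c <= 2 / 3 -> 0 <= q <= 1 -> unit_disc z ->
  Cmod z ^ 2 * q ^ 2 < Cmod (radicand c q z).
Proof.
intros Hc Hq Hz. unfold unit_disc in Hz. assert (P := Cmod_ge_0 z).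
assert (T := Cmod_radicand_diff c 1 q z (proj1 Hc) Hq).
rewrite radicand_at_1, Cmod_1 in T.
assert (H1 : 0 <= Cmod z ^ 2 < 1) by nra.
assert (H2 : 0 <= q ^ 2 <= 1) by nra.
set (r := Cmod z ^ 2) in *. set (k := q ^ 2) in *.
assert (c * (r * (1 - k)) <= 1 * (r * (1 - k))) by (apply Rmult_le_compat_r; [apply Rmult_le_pos |]; lra).
lra.
Qed.

Lemma Cmod_flow_sqr (c q : R) (z : C) :
  0 <= c <= 2 / 3 -> 0 <= q <= 1 -> unit_disc z ->
  Cmod (flow c q z) ^ 2 = Cmod z ^ 2 * q ^ 2 / Cmod (radicand c q z).
Proof.
intros Hc Hq Hz. assert (H := radicand_Re_pos c q z Hc Hq Hz).
assert (N := root_neq_0 _ H).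
unfold flow. rewrite !Cmod_mult, Cmod_inv, Cmod_R, Rabs_pos_eq by (auto; lra).
rewrite <- (Cmod_root_sqr _ H). apply Cmod_gt_0 in N. field. lra.
Qed.

Lemma flow_in_disc (c q : R) (z : C) :
  0 <= c <= 2 / 3 -> 0 <= q <= 1 -> unit_disc z -> unit_disc (flow c q z).
Proof.
intros Hc Hq Hz. assert (E := Cmod_flow_sqr c q z Hc Hq Hz).
assert (D := radicand_dominates c q z Hc Hq Hz).
assert (P := Cmod_ge_0 z). assert (P' := Cmod_ge_0 (flow c q z)).
assert (0 <= Cmod z ^ 2 * q ^ 2) by (apply Rmult_le_pos; apply pow2_ge_0).
assert (L : Cmod (flow c q z) ^ 2 < 1).
{ rewrite E. apply Rlt_div_l; lra. }
unfold unit_disc. nra.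
Qed.

(** * Every semiflow is the explicit one *)

Lemma exp_decay (a t : R) : 0 < a -> 0 <= t -> 0 < exp (- a * t) <= 1.
Proof.
intros Ha Ht. split; [apply exp_pos |].
destruct (Req_dec t 0) as [-> | N].
- rewrite Rmult_0_r, exp_0. lra.
- rewrite <- exp_0. apply Rlt_le, exp_increasing. nra.
Qed.

(** Time is squared in order to turn the derivative within the half-line t >= 0
into an ordinary derivative on R, also at t = 0. *)
Lemma semiflow_square_time (f : C -> C) (phi : R -> C -> C) (z : C) (s : R) :
  is_semiflow f phi -> unit_disc z ->
  is_curve_derive (fun u => phi (u ^ 2) z) s
    (RtoC (2 * s) * f (phi (s ^ 2)%R z))%C.
Proof.
intros Hphi Hz. destruct (Hphi z Hz) as [_ H].
destruct (H (s ^ 2) (pow2_ge_0 s)) as [_ [_ L]]. clear H Hphi.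
set (l := f (phi (s ^ 2) z)) in *.
apply curve_derive_iff. intros eps.
assert (Pl := Cmod_ge_0 l). assert (E := cond_pos eps). assert (Ps := Rabs_pos s).
assert (He : 0 < eps / (2 * (2 * Rabs s + 1))) by (apply Rdiv_lt_0_compat; lra).
assert (Lim : is_filter_lim (within (fun s0 => 0 <= s0) (locally (s ^ 2))) (s ^ 2)).
{ intros P [d HP]. exists d. intros u Hu _. apply HP, Hu. }
destruct (L _ Lim (mkposreal _ He)) as [d Hd]. simpl pos in Hd.
assert (Hd' : 0 < Rmin 1 (Rmin (d / (2 * Rabs s + 1)) (eps / (2 * (Cmod l + 1))))).
{ assert (P := cond_pos d). repeat apply Rmin_pos; [lra | |]; apply Rdiv_lt_0_compat; lra. }
exists (mkposreal _ Hd'). intros u Hu. simpl in Hu.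
apply Rmin_Rgt_l in Hu. destruct Hu as [Hu1 Hu]. apply Rmin_Rgt_l in Hu. destruct Hu as [Hu2 Hu3].
assert (Pu := Rabs_pos (u - s)).
assert (Q : Rabs (u ^ 2 - s ^ 2) <= (2 * Rabs s + 1) * Rabs (u - s)).
{ replace (u ^ 2 - s ^ 2) with ((2 * s + (u - s)) * (u - s)) by ring.
  rewrite Rabs_mult. apply Rmult_le_compat_r; [exact Pu |].
  apply Rle_trans with (1 := Rabs_triang _ _). rewrite Rabs_mult, (Rabs_pos_eq 2) by lra. lra. }
assert (Hb : Rabs (u ^ 2 - s ^ 2) < d).
{ apply Rle_lt_trans with (1 := Q). apply Rgt_lt in Hu2.
  apply (Rmult_lt_compat_l (2 * Rabs s + 1)) in Hu2; [| lra].
  replace ((2 * Rabs s + 1) * (d / (2 * Rabs s + 1))) with (d : R) in Hu2 by (field; lra). exact Hu2. }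
assert (B1 : Cmod (phi (u ^ 2)%R z - phi (s ^ 2)%R z - RtoC (u ^ 2 - s ^ 2) * l)
  <= eps / (2 * (2 * Rabs s + 1)) * Rabs (u ^ 2 - s ^ 2)).
{ rewrite <- curve_remainder, <- C_R_norm. exact (Hd (u ^ 2) Hb (pow2_ge_0 u)). }
(* u^2 - s^2 - 2 s (u - s) = (u - s)^2 is the error from squaring the time. *)
replace (phi (u ^ 2)%R z - phi (s ^ 2)%R z - RtoC (u - s) * (RtoC (2 * s) * l))%C with
  ((phi (u ^ 2)%R z - phi (s ^ 2)%R z - RtoC (u ^ 2 - s ^ 2) * l) + RtoC ((u - s) ^ 2) * l)%C
  by (rewrite !RtoC_minus, !RtoC_pow, !RtoC_mult, RtoC_minus; ring).
apply Rle_trans with (1 := Cmod_triangle _ _).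
replace (eps * Rabs (u - s)) with (eps / (2 * (2 * Rabs s + 1)) * ((2 * Rabs s + 1) * Rabs (u - s))
  + eps / (2 * (Cmod l + 1)) * Rabs (u - s) * (Cmod l + 1)) by (field; lra).
apply Rplus_le_compat.
- apply Rle_trans with (1 := B1). apply Rmult_le_compat_l; lra.
- rewrite Cmod_mult, Cmod_R, <- RPow_abs.
  apply Rmult_le_compat; [apply pow2_ge_0 | exact Pl | | lra].
  simpl. rewrite Rmult_1_r. apply Rmult_le_compat_r; lra.
Qed.

Lemma flow_square_time (a c : R) (z : C) (s : R) :
  0 < a -> 0 <= c <= 2 / 3 -> unit_disc z ->
  is_curve_derive
    (fun u => flow c (exp (- a * u ^ 2)) z) s
    (RtoC (2 * s) * f_c a c (flow c (exp (- a * s ^ 2)) z))%C.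
Proof.
intros Ha Hc Hz.
assert (Hq : 0 <= exp (- a * s ^ 2) <= 1).
{ destruct (exp_decay a (s ^ 2) Ha (pow2_ge_0 s)). lra. }
assert (H := radicand_Re_pos c _ z Hc Hq Hz).
assert (D := derive_along_curve (fun p => flow c p z) (fun u => RtoC (exp (- a * u ^ 2))) s _
   (RtoC (- (2 * a * s * exp (- a * s ^ 2)))) (flow_derive_q c _ z H)).
rewrite f_c_flow by exact H.
match type of D with _ -> is_derive _ _ ?l => match goal with |- is_derive _ _ ?r => replace r with l end end.
- apply D. apply RtoC_curve_derive. auto_derive; [exact I | simpl; ring].
- rewrite Cmult_assoc, Cmult_assoc. f_equal. rewrite <- !RtoC_mult. f_equal. ring.
Qed.

(** The difference f z - f w equals - a (z - w) (1 - c (z^2 + z w + w^2)), and the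
real part of c (z^2 + z w + w^2) is at most 3 c <= 2 on the disc.  The left side
of the inequality is the real inner product of z - w and f z - f w. *)
Lemma one_sided_lipschitz (c : R) (a : R) (z w : C) :
  0 < a -> 0 <= c <= 2 / 3 -> unit_disc z -> unit_disc w ->
  let d := (z - w)%C in let e := (f_c a c z - f_c a c w)%C in
  fst d * fst e + snd d * snd e <= a * (fst d ^ 2 + snd d ^ 2).
Proof.
intros Ha Hc Hz Hw d e.
set (Q := (z * z + z * w + w * w)%C).
assert (BQ : Re Q <= 3).
{ assert (T := re_le_Cmod Q). assert (T' := Rle_abs (Re Q)).
  assert (T1 := Cmod_triangle (z * z + z * w) (w * w)).
  assert (T2 := Cmod_triangle (z * z) (z * w)). fold Q in T1.
  rewrite !Cmod_mult in *. unfold unit_disc in *.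
  assert (P := Cmod_ge_0 z). assert (P' := Cmod_ge_0 w). nra. }
assert (E : e = (d * (RtoC (- a) * (1 - RtoC c * Q)))%C).
{ unfold e, d, Q, f_c. rewrite RtoC_opp. ring. }
set (k := (RtoC (- a) * (1 - RtoC c * Q))%C) in *.
assert (Hk : Re k <= a).
{ replace (Re k) with (- a * (1 - c * Re Q)) by (unfold k; generalize Q; intros [x y]; simpl; ring). 
  assert (c * Re Q <= c * 3) by (apply Rmult_le_compat_l; lra). nra. }
rewrite E. destruct d as [p r], k as [k1 k2]. simpl in *.
assert (0 <= p * p + r * r) by nra. 
assert ((p * p + r * r) * k1 <= (p * p + r * r) * a) by (apply Rmult_le_compat_l; lra).
lra.
Qed.

(** The squared distance N between two solutions, damped by exp (- 2 a t), is
nonincreasing by the one-sided Lipschitz bound and vanishes at time 0. *)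
Lemma semiflow_explicit (a c : R) (phi : R -> C -> C) (z : C) (t : R) :
  0 < a -> 0 <= c <= 2 / 3 -> is_semiflow (f_c a c) phi -> unit_disc z -> 0 <= t ->
  phi t z = flow c (exp (- a * t)) z.
Proof.
intros Ha Hc Hphi Hz Ht.
(* Time t is replaced by u^2, which makes both curves differentiable on all
   of R and in particular two-sidedly at 0. *)
set (w := fun u : R => phi (u ^ 2) z).
set (v := fun u : R => flow c (exp (- a * u ^ 2)) z).
set (p := fun u => fst (w u) - fst (v u)).
set (r := fun u => snd (w u) - snd (v u)).
set (e := fun u => (f_c a c (w u) - f_c a c (v u))%C).
assert (Dp : forall s, is_derive p s (2 * s * fst (e s))).
{ intros s. destruct (curve_derive_components _ _ _ (semiflow_square_time _ _ z s Hphi Hz)) as [D1 _].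
  destruct (curve_derive_components _ _ _ (flow_square_time a c z s Ha Hc Hz)) as [D2 _].
  assert (D := is_derive_minus _ _ _ _ _ D1 D2).
  replace (2 * s * fst (e s)) with
    (minus (fst (RtoC (2 * s) * f_c a c (w s))%C) (fst (RtoC (2 * s) * f_c a c (v s))%C));
    [exact D |].
  unfold minus, plus, opp, e; simpl. ring. }
assert (Dr : forall s, is_derive r s (2 * s * snd (e s))).
{ intros s. destruct (curve_derive_components _ _ _ (semiflow_square_time _ _ z s Hphi Hz)) as [_ D1].
  destruct (curve_derive_components _ _ _ (flow_square_time a c z s Ha Hc Hz)) as [_ D2].
  assert (D := is_derive_minus _ _ _ _ _ D1 D2).
  replace (2 * s * snd (e s)) with
    (minus (snd (RtoC (2 * s) * f_c a c (w s))%C) (snd (RtoC (2 * s) * f_c a c (v s))%C));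
    [exact D |].
  unfold minus, plus, opp, e; simpl. ring. }
(* For s > 0, N' s has the sign of Re (conj (w - v) (f w - f v)) - a |w - v|^2. *)
set (N := fun s => (p s ^ 2 + r s ^ 2) * exp (- (2 * a) * s ^ 2)).
set (N' := fun s => exp (- (2 * a) * s ^ 2) * (4 * s) *
   (p s * fst (e s) + r s * snd (e s) - a * (p s ^ 2 + r s ^ 2))).
assert (DN : forall s, is_derive N s (N' s)).
{ intros s. unfold N. auto_derive.
  - repeat split; [exists (2 * s * fst (e s)); apply Dp | exists (2 * s * snd (e s)); apply Dr].
  - replace (Derive (fun x => p x) s) with (2 * s * fst (e s))
      by (symmetry; apply is_derive_unique, Dp).
    replace (Derive (fun x => r x) s) with (2 * s * snd (e s))
      by (symmetry; apply is_derive_unique, Dr).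
    unfold N'. simpl. ring. }
assert (HN : forall s, 0 <= s -> N' s <= 0).
{ intros s Hs. unfold N'.
  assert (X : p s * fst (e s) + r s * snd (e s) <= a * (p s ^ 2 + r s ^ 2)).
  { apply (one_sided_lipschitz c a (w s) (v s) Ha Hc).
    - destruct (Hphi z Hz) as [_ H]. apply (H (s ^ 2) (pow2_ge_0 s)).
    - apply flow_in_disc; [exact Hc | | exact Hz].
      destruct (exp_decay a (s ^ 2) Ha (pow2_ge_0 s)). lra. }
  assert (0 <= exp (- (2 * a) * s ^ 2) * (4 * s)) by (apply Rmult_le_pos; [apply Rlt_le, exp_pos | lra]).
  nra. }
assert (N0 : N 0 = 0).
{ unfold N, p, r, w, v. replace (0 ^ 2) with 0 by ring.
  destruct (Hphi z Hz) as [E _]. rewrite E, Rmult_0_r, exp_0, flow_at_1. ring. }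
assert (S0 := sqrt_pos t).
destruct (MVT_gen N 0 (sqrt t) N') as [xi [Hxi Exi]].
- intros s _. apply DN.
- intros s _. apply derivable_continuous_pt. exists (N' s). apply is_derive_Reals, DN.
- rewrite Rmin_left in Hxi by exact S0.
  assert (Nle : N (sqrt t) <= 0).
  { assert (T := HN xi (proj1 Hxi)). nra. }
  unfold N in Nle. assert (X := exp_pos (- (2 * a) * sqrt t ^ 2)).
  assert (p (sqrt t) ^ 2 + r (sqrt t) ^ 2 <= 0) by nra.
  assert (p (sqrt t) = 0) by nra. assert (r (sqrt t) = 0) by nra.
  unfold p, r, w, v in *. rewrite pow2_sqrt in * by exact Ht.
  apply injective_projections; lra.
Qed.

(** * Contraction of the Kobayashi metric *)

(** The bound 2/3 is sharp: if P = d and x = k d, then to first order in d the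
inequality reads k <= 2/3. *)
Lemma cubic_gap_le (b1 b2 x P d : R) :
  0 < b1 -> 0 < b2 -> b1 ^ 2 <= b2 ^ 2 + x -> 0 <= d <= P -> P < b1 ^ 2 -> x <= 2 / 3 * d ->
  b1 * (b1 ^ 2 - P) <= b2 * (b2 ^ 2 - (P - d)).
Proof.
intros H1 H2 Hx Hd HP Hxd.
destruct (Rle_or_lt b1 b2) as [L | L].
- assert (b1 ^ 2 <= b2 ^ 2) by nra. apply Rmult_le_compat; lra.
- (* Here y, the drop of b^2, satisfies 3y/2 <= d <= P, whence Q <= b2^2; the
     loss (b1 - b2) Q is then covered by the gain d - y >= y/2. *)
  set (y := b1 ^ 2 - b2 ^ 2).
  assert (Hy : 3 / 2 * y <= d) by (unfold y; lra).
  assert (0 < y) by (unfold y; nra).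
  set (Q := b1 ^ 2 - P).
  assert (HQ : Q <= b2 ^ 2) by (unfold Q, y in *; lra).
  assert (K : (b1 - b2) * Q <= b2 * (y / 2)).
  { replace y with ((b1 - b2) * (b1 + b2)) by (unfold y; ring).
    replace (b2 * ((b1 - b2) * (b1 + b2) / 2)) with ((b1 - b2) * (b2 * (b1 + b2) / 2)) by field.
    apply Rmult_le_compat_l; [lra |]. nra. }
  apply Rle_trans with (b2 * (Q + y / 2)); [lra |].
  apply Rmult_le_compat_l; [lra |]. unfold Q, y in *. lra.
Qed.

Lemma F_K_flow (c q : R) (z v : C) :
  0 <= c <= 2 / 3 -> 0 <= q <= 1 -> unit_disc z ->
  F_K (flow c q z) (flow_deriv c q z * v) =
  let b := Cmod (root (radicand c q z)) in
  q * (Cmod v / (b * (b ^ 2 - Cmod z ^ 2 * q ^ 2))).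
Proof.
intros Hc Hq Hz. assert (H := radicand_Re_pos c q z Hc Hq Hz).
assert (N := root_neq_0 _ H).
assert (D := radicand_dominates c q z Hc Hq Hz).
unfold F_K, flow_deriv. rewrite Cmod_flow_sqr by assumption.
unfold Cdiv. rewrite !Cmod_mult, Cmod_inv, Cmod_pow, Cmod_R, (Rabs_pos_eq q)
  by (try lra; apply Cpow_nz, N).
rewrite <- (Cmod_root_sqr _ H) in *. apply Cmod_gt_0 in N. simpl. field. lra.
Qed.

(** The flow between the times that correspond to q1 and q2 contracts the metric by
the quotient of the two exponentials. *)
Lemma F_K_flow_contracts (c q1 q2 : R) (z v : C) :
  0 <= c <= 2 / 3 -> 0 < q2 -> q2 <= q1 -> q1 <= 1 -> unit_disc z ->
  F_K (flow c q2 z) (flow_deriv c q2 z * v) <=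
  q2 / q1 * F_K (flow c q1 z) (flow_deriv c q1 z * v).
Proof.
intros Hc H0 H12 H1 Hz.
assert (B : forall q, q2 <= q <= q1 -> 0 < Cmod (root (radicand c q z)) /\
  Cmod (root (radicand c q z)) ^ 2 = Cmod (radicand c q z) /\ 
  Cmod z ^ 2 * q ^ 2 < Cmod (radicand c q z)).
{ intros q Hq. assert (H : 0 < Re (radicand c q z)) by (apply radicand_Re_pos; [| lra |]; assumption).
  repeat split.
  - apply Cmod_gt_0, root_neq_0, H.
  - apply Cmod_root_sqr, H.
  - apply radicand_dominates; [| lra |]; assumption. }
destruct (B q1) as (P1 & S1 & D1); [lra |]. destruct (B q2) as (P2 & S2 & D2); [lra |].
assert (T := Cmod_radicand_diff c q1 q2 z (proj1 Hc) (conj (Rlt_le _ _ H0) H12)).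
rewrite !F_K_flow by (try assumption; lra).
set (b1 := Cmod (root (radicand c q1 z))) in *. set (b2 := Cmod (root (radicand c q2 z))) in *.
rewrite <- S1 in *. rewrite <- S2 in *. cbv zeta.
set (r := Cmod z ^ 2) in *.
assert (Hr : 0 <= r) by apply pow2_ge_0.
assert (K : b1 * (b1 ^ 2 - r * q1 ^ 2) <= b2 * (b2 ^ 2 - r * q2 ^ 2)).
{ replace (r * q2 ^ 2) with (r * q1 ^ 2 - r * (q1 ^ 2 - q2 ^ 2)) by ring.
  assert (0 <= q2 ^ 2 <= q1 ^ 2) by nra.
  assert (0 <= r * (q1 ^ 2 - q2 ^ 2)) by (apply Rmult_le_pos; lra).
  assert (0 <= r * q2 ^ 2) by (apply Rmult_le_pos; lra).
  apply cubic_gap_le with (c * r * (q1 ^ 2 - q2 ^ 2)); try lra.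
  rewrite Rmult_assoc. apply Rmult_le_compat_r; lra. }
replace (q2 / q1 * (q1 * (Cmod v / (b1 * (b1 ^ 2 - r * q1 ^ 2)))))
  with (q2 * (Cmod v / (b1 * (b1 ^ 2 - r * q1 ^ 2)))) by (field; lra).
apply Rmult_le_compat_l; [lra |]. apply Rmult_le_compat_l; [apply Cmod_ge_0 |].
apply Rinv_le_contravar; [apply Rmult_lt_0_compat; lra | exact K].
Qed.

Lemma F_K_ge0 (z v : C) : unit_disc z -> 0 <= F_K z v.
Proof.
intros Hz. unfold unit_disc in Hz. assert (P := Cmod_ge_0 z). assert (Q := Cmod_ge_0 v).
apply Rdiv_le_0_compat; [exact Q |]. nra.
Qed.

(** * Dini derivatives and the contraction rate *)

Lemma Dini_upper_le (g : R -> R) (t l : R) :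
  (forall eps : posreal, exists delta, 0 < delta /\
     forall e, 0 < e < delta -> (g (t + e) - g t) / e <= l + eps) ->
  Rbar_le (Dini_upper g t) (Finite l).
Proof.
intros H.
assert (B : forall eps : posreal, Rbar_le (Dini_upper g t) (Finite (l + eps))).
{ intros eps. destruct (H eps) as [d [Hd He]].
  set (S := fun q => exists e, 0 < e < d /\ q = (g (t + e) - g t) / e).
  apply Rbar_le_trans with (Lub_Rbar S).
  - unfold Dini_upper, Rbar_glb. destruct Rbar_ex_glb as [m [Hm Hm2]]; simpl.
    apply Hm. exists d. split; [exact Hd | reflexivity].
  - destruct (Lub_Rbar_correct S) as [_ L]. apply L.
    intros q [e [Hed ->]]. exact (He e Hed). }
destruct (Dini_upper g t) as [r | |]; simpl in *.
- apply le_epsilon. intros eps Heps. exact (B (mkposreal eps Heps)).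
- exact (B (mkposreal 1 Rlt_0_1)).
- exact I.
Qed.

Lemma Dini_upper_ge (g : R -> R) (t l : R) :
  (forall e, 0 < e -> l <= (g (t + e) - g t) / e) ->
  Rbar_le (Finite l) (Dini_upper g t).
Proof.
intros H. unfold Dini_upper, Rbar_glb. destruct Rbar_ex_glb as [m [Hm2 Hm]].
apply (Hm (Finite l)). intros y [d [Hd ->]].
set (S := fun q => exists e, 0 < e < d /\ q = (g (t + e) - g t) / e).
apply Rbar_le_trans with (Finite ((g (t + d / 2) - g t) / (d / 2))).
- apply H. lra.
- destruct (Lub_Rbar_correct S) as [L _]. apply L. exists (d / 2). split; [lra | reflexivity].
Qed.

(** Follows from exp (- x) = / exp x <= / (1 + x). *)
Lemma exp_neg_le (x : R) : 0 <= x -> exp (- x) <= 1 - x + x ^ 2.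
Proof.
intros Hx. rewrite exp_Ropp. apply Rle_trans with (/ (1 + x)).
- apply Rinv_le_contravar; [lra | apply exp_ineq1_le].
- apply Rmult_le_reg_r with (1 + x); [lra |]. rewrite Rinv_l by lra.
  assert (0 <= x ^ 3) by (apply pow_le, Hx). nra.
Qed.

Lemma Dini_upper_exp_decay (g : R -> R) (a t : R) : 0 < a -> 0 <= g t ->
  (forall e, 0 < e -> g (t + e) <= exp (- a * e) * g t) ->
  Rbar_le (Dini_upper g t) (Finite (- a * g t)).
Proof.
intros Ha Hg H. apply Dini_upper_le. intros eps. assert (E := cond_pos eps).
assert (P : 0 <= a ^ 2 * g t) by (apply Rmult_le_pos; [apply pow2_ge_0 | exact Hg]).
exists (eps / (a ^ 2 * g t + 1)). split; [apply Rdiv_lt_0_compat; lra |].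
intros e [He1 He2].
assert (He3 : e * (a ^ 2 * g t + 1) < eps) by (apply Rlt_div_r; [lra | exact He2]).
apply Rle_div_l; [exact He1 |].
assert (X := exp_neg_le (a * e)). 
replace (- (a * e)) with (- a * e) in X by ring.
assert (Y := H e He1).
assert (Z : exp (- a * e) * g t <= (1 - a * e + (a * e) ^ 2) * g t).
{ apply Rmult_le_compat_r; [exact Hg |]. apply X. apply Rmult_le_pos; lra. }
assert (W : e * (a ^ 2 * g t) * e <= eps * e) by (apply Rmult_le_compat_r; lra).
lra.
Qed.

Lemma semiflow_variation (a c : R) (phi : R -> C -> C) (z v : C) (t : R) :
  0 < a -> 0 <= c <= 2 / 3 -> is_semiflow (f_c a c) phi -> unit_disc z -> 0 <= t ->
  variation phi z v t = (flow_deriv c (exp (- a * t)) z * v)%C.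
Proof.
intros Ha Hc Hphi Hz Ht. unfold variation. f_equal. apply is_C_derive_unique.
(* The disc is open, so the time-t map is the explicit one near z. *)
destruct (exp_decay a t Ha Ht) as [Q1 Q2].
apply is_derive_ext_loc with
  (2 := flow_derive_z c _ z (radicand_Re_pos c _ z Hc (conj (Rlt_le _ _ Q1) Q2) Hz)).
unfold unit_disc in Hz.
assert (Hd : 0 < 1 - Cmod z) by lra.
exists (mkposreal _ Hd). intros w Hw. symmetry. apply (semiflow_explicit a); try assumption.
change (Cmod (w - z) < 1 - Cmod z) in Hw. unfold unit_disc.
assert (T := Cmod_le_sub_add w z). lra.
Qed.

Lemma semiflow_intrinsically_contracting (a c : R) (phi : R -> C -> C) :
  0 < a -> 0 <= c <= 2 / 3 -> is_semiflow (f_c a c) phi ->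
  intrinsically_contracting phi a.
Proof.
intros Ha Hc Hphi. split; [exact Ha |]. intros z v Hz g t Ht.
assert (G : forall s, 0 <= s -> let q := exp (- a * s) in
   g s = F_K (flow c q z) (flow_deriv c q z * v)).
{ intros s Hs. unfold g. rewrite (semiflow_variation a c) by assumption.
  rewrite (semiflow_explicit a c) by assumption. reflexivity. }
destruct (exp_decay a t Ha Ht) as [Q1 Q2].
apply Dini_upper_exp_decay; [exact Ha | |].
- rewrite G by exact Ht. apply F_K_ge0, flow_in_disc; [exact Hc | lra | exact Hz].
- intros e He. rewrite !G by lra. cbv zeta.
  replace (exp (- a * e)) with (exp (- a * (t + e)) / exp (- a * t)).
  + assert (Hle : exp (- a * (t + e)) <= exp (- a * t)).
    { apply Rlt_le, exp_increasing. nra. }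
    apply F_K_flow_contracts; try assumption. apply exp_pos.
  + rewrite Rmult_plus_distr_l, exp_plus. field. apply Rgt_not_eq, exp_pos.
Qed.

(** The difference quotients of exp (- a t) at t = 0 are all at least - a, so the
Dini derivative at the fixed point is too. *)
Lemma contraction_rate_le (a c : R) (phi : R -> C -> C) (lambda : R) :
  0 < a -> 0 <= c <= 2 / 3 -> is_semiflow (f_c a c) phi ->
  intrinsically_contracting phi lambda -> lambda <= a.
Proof.
intros Ha Hc Hphi [_ H].
assert (Hz : unit_disc 0) by (unfold unit_disc; rewrite Cmod_0; lra).
(* Along the fixed point 0 the derivative of the time-s map is exp (- a s). *)
specialize (H 0%C 1%C Hz). set (g := fun t => _) in H.
assert (G : forall s, 0 <= s -> g s = exp (- a * s)).
{ intros s Hs. unfold g. rewrite (semiflow_variation a c) by assumption.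
  rewrite (semiflow_explicit a c) by assumption.
  assert (E : radicand c (exp (- a * s)) 0 = 1%C) by (unfold radicand; ring).
  unfold flow, flow_deriv. rewrite E, root_1.
  replace (0 * exp (- a * s) * / 1)%C with (RtoC 0) by field.
  replace (exp (- a * s) / 1 ^ 3 * 1)%C with (RtoC (exp (- a * s))) by field.
  unfold F_K. rewrite Cmod_0, Cmod_R, Rabs_pos_eq by apply Rlt_le, exp_pos. field. }
assert (L : Rbar_le (Finite (- a)) (Dini_upper g 0)).
{ apply Dini_upper_ge. intros e He. rewrite !G, Rplus_0_l, Rmult_0_r, exp_0 by lra.
  apply Rle_div_r; [exact He |]. assert (X := exp_ineq1_le (- a * e)). lra. }
assert (T := Rbar_le_trans _ _ _ L (H 0 (Rle_refl 0))).
simpl in T. fold g in T. rewrite G, Rmult_0_r, exp_0 in T by lra. lra.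
Qed.

(** * Curves and their lengths *)

Lemma filterlim_Cmult {T : Type} {F : (T -> Prop) -> Prop} {FF : Filter F}
  (f g : T -> C) (x y : C) :
  filterlim f F (locally (T := C_UniformSpace) x) ->
  filterlim g F (locally (T := C_UniformSpace) y) ->
  filterlim (fun t => f t * g t)%C F (locally (T := C_UniformSpace) (x * y)%C).
Proof.
intros Hf Hg P HP. apply locally_C in HP.
apply (filterlim_comp_2 (G := locally (T := AbsRing_UniformSpace C_AbsRing) x)
  (H := locally (T := AbsRing_UniformSpace C_AbsRing) y) f g Cmult) with (4 := HP).
- intros Q HQ. apply Hf. apply locally_C. exact HQ.
- intros Q HQ. apply Hg. apply locally_C. exact HQ.
- exact (filterlim_mult (K := C_AbsRing) x y).
Qed.

Lemma complex_derive_continuous (f : C -> C) (z l : C) :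
  is_complex_derive f z l ->
  filterlim f (locally (T := C_UniformSpace) z) (locally (T := C_UniformSpace) (f z)).
Proof.
intros H P HP. apply locally_C.
exact (ex_derive_continuous (K := C_AbsRing) (V := C_NormedModule) f z (ex_intro _ l H) P HP).
Qed.

Definition clamp (u w s : R) : R := Rmax u (Rmin w s).

Lemma clamp_in (u w s : R) : u <= w -> u <= clamp u w s <= w.
Proof. intros H. unfold clamp, Rmax, Rmin. repeat destruct Rle_dec; lra. Qed.

Lemma clamp_id (u w s : R) : u <= s <= w -> clamp u w s = s.
Proof. intros H. unfold clamp, Rmax, Rmin. repeat destruct Rle_dec; lra. Qed.

Lemma clamp_lipschitz (u w s r : R) : Rabs (clamp u w s - clamp u w r) <= Rabs (s - r).
Proof. unfold clamp, Rmax, Rmin, Rabs. repeat destruct Rle_dec; repeat destruct Rcase_abs; lra. Qed.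

(** Composition with the retraction of R onto [u, w] extends a function that is only
relatively continuous on [u, w] to one that is continuous on R. *)
Lemma ex_RInt_continuous_on (h : R -> R) (u w : R) : u <= w ->
  continuous_on (fun s => u <= s <= w) h -> ex_RInt h u w.
Proof.
intros Huw Hh. apply ex_RInt_ext with (fun s => h (clamp u w s)).
- intros s. rewrite Rmin_left, Rmax_right by exact Huw. intros Hs. rewrite clamp_id; lra.
- apply (ex_RInt_continuous (V := R_CompleteNormedModule)). intros s _ P HP.
  destruct (Hh _ (clamp_in u w s Huw) P HP) as [d Hd].
  exists d. intros r Hr. apply Hd; [| apply clamp_in, Huw].
  apply Rle_lt_trans with (1 := clamp_lipschitz u w r s). exact Hr.
Qed.

Lemma continuous_on_F_K (D : R -> Prop) (gamma g : R -> C) :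
  (forall s, D s -> unit_disc (gamma s)) ->
  continuous_on D gamma -> continuous_on D g -> continuous_on D (fun s => F_K (gamma s) (g s)).
Proof.
intros Hd Hgam Hg s Hs. specialize (Hgam s Hs). specialize (Hg s Hs). specialize (Hd s Hs).
assert (N : forall h : R -> C, filterlim h (within D (locally s)) (locally (h s)) ->
   filterlim (fun r => Cmod (h r)) (within D (locally s)) (locally (Cmod (h s)))).
{ intros h Hh. apply filterlim_comp with (1 := Hh).
  exact (filterlim_norm (K := C_AbsRing) (V := C_NormedModule) (h s)). }
unfold F_K, Rdiv.
apply (filterlim_comp_2 (G := locally (Cmod (g s))) (H := locally (/ (1 - Cmod (gamma s) ^ 2)))
   (fun r => Cmod (g r)) (fun r => / (1 - Cmod (gamma r) ^ 2)) Rmult).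
- apply N, Hg.
- apply filterlim_comp with (1 := N _ Hgam) (g := fun x => / (1 - x ^ 2)).
  apply (ex_derive_continuous (fun x => / (1 - x ^ 2))). auto_derive.
  unfold unit_disc in Hd. assert (P := Cmod_ge_0 (gamma s)). nra.
- exact (filterlim_mult (K := R_AbsRing) _ _).
Qed.

Lemma velocity_derive (gamma : R -> C) (s : R) (l : C) :
  is_curve_derive gamma s l -> velocity gamma s = l.
Proof.
intros H. destruct (curve_derive_components _ _ _ H) as [H1 H2].
rewrite (surjective_pairing l). unfold velocity.
f_equal; apply is_derive_unique; assumption.
Qed.

Lemma continuous_on_comp_derivable (D : R -> Prop) (gamma : R -> C) (f : C -> C) :
  continuous_on D gamma ->
  (forall s, D s -> exists l, is_complex_derive f (gamma s) l) ->
  continuous_on D (fun s => f (gamma s)).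
Proof.
intros Hg Hf s Hs. destruct (Hf s Hs) as [l Hl].
exact (filterlim_comp _ _ _ gamma f _ _ _ (Hg s Hs) (complex_derive_continuous f _ l Hl)).
Qed.

Lemma smooth_piece_flow (c q u w : R) (gamma : R -> C) :
  0 <= c <= 2 / 3 -> 0 <= q <= 1 ->
  continuous_on (fun s => u <= s <= w) gamma ->
  (forall s, u <= s <= w -> unit_disc (gamma s)) ->
  smooth_piece gamma u w ->
  smooth_piece (fun s => flow c q (gamma s)) u w.
Proof.
intros Hc Hq Hcont Hd [g [Hg Hder]].
exists (fun s => (g s * flow_deriv c q (gamma s))%C). split.
- intros s Hs. apply filterlim_Cmult.
  + apply Hg, Hs.
  + apply (continuous_on_comp_derivable (fun s => u <= s <= w)); [exact Hcont | | exact Hs].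
    intros r Hr. apply flow_deriv_derivable, radicand_Re_pos; auto.
- intros s Hs. apply derive_along_curve; [| apply Hder, Hs].
  apply flow_derive_z, radicand_Re_pos; try assumption. apply Hd. lra.
Qed.

Lemma piece_integrable (gamma : R -> C) (u w : R) : u <= w ->
  continuous_on (fun s => u <= s <= w) gamma ->
  (forall s, u <= s <= w -> unit_disc (gamma s)) ->
  smooth_piece gamma u w ->
  ex_RInt (fun s => F_K (gamma s) (velocity gamma s)) u w.
Proof.
intros Huw Hcont Hd [g [Hg Hder]].
apply ex_RInt_ext with (fun s => F_K (gamma s) (g s)).
- intros s. rewrite Rmin_left, Rmax_right by exact Huw. intros Hs.
  rewrite (velocity_derive _ _ _ (Hder s Hs)). reflexivity.
- apply ex_RInt_continuous_on; [exact Huw |]. apply continuous_on_F_K; assumption.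
Qed.

(** The comparison is made piece by piece because the velocity has no meaning at the
break points, where a pointwise inequality may fail. *)
Lemma RInt_le_partition (G H : R -> R) (n : nat) (sigma : nat -> R) :
  (forall i, (i < n)%nat ->
     ex_RInt G (sigma i) (sigma (S i)) /\ ex_RInt H (sigma i) (sigma (S i)) /\
     RInt G (sigma i) (sigma (S i)) <= RInt H (sigma i) (sigma (S i))) ->
  ex_RInt G (sigma 0%nat) (sigma n) /\ ex_RInt H (sigma 0%nat) (sigma n) /\
  RInt G (sigma 0%nat) (sigma n) <= RInt H (sigma 0%nat) (sigma n).
Proof.
induction n as [| n IH]; intros Hi.
- repeat split; try apply ex_RInt_point. rewrite !RInt_point. lra.
- destruct IH as (A1 & A2 & A3); [intros i Hn; apply Hi; lia |].
  destruct (Hi n) as (B1 & B2 & B3); [lia |].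
  repeat split; [apply (ex_RInt_Chasles _ _ _ _ A1 B1) | apply (ex_RInt_Chasles _ _ _ _ A2 B2) |].
  rewrite <- (RInt_Chasles _ _ _ _ A1 B1), <- (RInt_Chasles _ _ _ _ A2 B2).
  apply Rplus_le_compat; assumption.
Qed.

Lemma partition_monotone (n : nat) (sigma : nat -> R) :
  (forall i, (i < n)%nat -> sigma i < sigma (S i)) ->
  forall i j, (i <= j <= n)%nat -> sigma i <= sigma j.
Proof.
intros H i j [Hij Hj]. induction Hij as [| j Hij IH]; [lra |].
assert (sigma j < sigma (S j)) by (apply H; lia). assert (sigma i <= sigma j) by (apply IH; lia). lra.
Qed.

Lemma curve_pieces (x y : C) (gamma : R -> C) : curve_in_disc x y gamma ->
  exists (n : nat) (sigma : nat -> R), sigma 0%nat = 0 /\ sigma n = 1 /\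
   forall i, (i < n)%nat -> sigma i < sigma (S i) /\
    smooth_piece gamma (sigma i) (sigma (S i)) /\
    continuous_on (fun s => sigma i <= s <= sigma (S i)) gamma /\
    (forall s, sigma i <= s <= sigma (S i) -> unit_disc (gamma s)).
Proof.
intros [[Hcont [n [sigma (H0 & H1 & Hlt & Hp)]]] [Hd _]].
exists n, sigma. split; [exact H0 |]. split; [exact H1 |]. intros i Hi.
assert (M := partition_monotone n sigma Hlt).
assert (0 <= sigma i) by (rewrite <- H0; apply M; lia).
assert (sigma (S i) <= 1) by (rewrite <- H1; apply M; lia).
split; [apply Hlt, Hi |]. split; [apply Hp, Hi |]. split.
- apply continuous_on_subset with (2 := Hcont). intros s Hs. lra.
- intros s Hs. apply Hd. lra.
Qed.

Lemma K_length_ge0 (x y : C) (gamma : R -> C) : curve_in_disc x y gamma -> 0 <= K_length gamma.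
Proof.
intros Hg. destruct (curve_pieces _ _ _ Hg) as [n [sigma (H0 & H1 & Hi)]].
destruct (RInt_le_partition (fun _ => 0) (fun s => F_K (gamma s) (velocity gamma s)) n sigma)
  as (_ & _ & T).
- intros i Hin. destruct (Hi i Hin) as (Hlt & Hp & Hcont & Hd).
  assert (I2 := piece_integrable gamma _ _ (Rlt_le _ _ Hlt) Hcont Hd Hp).
  split; [apply ex_RInt_const |]. split; [exact I2 |].
  apply RInt_le; [lra | apply ex_RInt_const | exact I2 |].
  intros s Hs. apply F_K_ge0, Hd. lra.
- rewrite RInt_const, H0, H1 in T. unfold K_length.
  apply Rle_trans with (2 := T), Req_le. symmetry. apply Rmult_0_r.
Qed.

Lemma flow_curve (c q : R) (x y : C) (gamma : R -> C) :
  0 <= c <= 2 / 3 -> 0 <= q <= 1 ->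
  curve_in_disc x y gamma ->
  curve_in_disc (flow c q x) (flow c q y) (fun s => flow c q (gamma s)).
Proof.
intros Hc Hq Hg. destruct (curve_pieces _ _ _ Hg) as [n [sigma (H0 & H1 & Hi)]].
destruct Hg as [[Hcont _] [Hd [Ex Ey]]].
split; [split |].
- apply continuous_on_comp_derivable; [exact Hcont |].
  intros s Hs. eexists. apply flow_derive_z, radicand_Re_pos; auto.
- exists n, sigma. split; [exact H0 |]. split; [exact H1 |].
  split; intros i Hin; destruct (Hi i Hin) as (Hlt & Hp & Hcont' & Hd'); [exact Hlt |].
  apply smooth_piece_flow; assumption.
- split; [intros s Hs; apply flow_in_disc; auto |]. rewrite Ex, Ey. split; reflexivity.
Qed.

Lemma K_length_flow (c q : R) (x y : C) (gamma : R -> C) :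
  0 <= c <= 2 / 3 -> 0 < q <= 1 ->
  curve_in_disc x y gamma ->
  K_length (fun s => flow c q (gamma s)) <= q * K_length gamma.
Proof.
intros Hc Hq Hg. destruct (curve_pieces _ _ _ Hg) as [n [sigma (H0 & H1 & Hi)]].
assert (Hq' : 0 <= q <= 1) by lra.
set (G := fun s => F_K (flow c q (gamma s)) (velocity (fun r => flow c q (gamma r)) s)).
set (H := fun s => F_K (gamma s) (velocity gamma s)).
assert (T : ex_RInt G (sigma 0%nat) (sigma n) /\ ex_RInt (fun s => q * H s) (sigma 0%nat) (sigma n) /\
  RInt G (sigma 0%nat) (sigma n) <= RInt (fun s => q * H s) (sigma 0%nat) (sigma n)).
{ apply RInt_le_partition. intros i Hin. destruct (Hi i Hin) as (Hlt & Hp & Hcont & Hd).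
  assert (I2 : ex_RInt (fun s => q * H s) (sigma i) (sigma (S i))).
  { apply (ex_RInt_scal (V := R_NormedModule) H).
    apply (piece_integrable gamma _ _ (Rlt_le _ _ Hlt) Hcont Hd Hp). }
  assert (I1 : ex_RInt G (sigma i) (sigma (S i))).
  { apply (piece_integrable (fun s => flow c q (gamma s))); [lra | | |].
    - apply continuous_on_comp_derivable; [exact Hcont |].
      intros s Hs. eexists. apply flow_derive_z, radicand_Re_pos; auto.
    - intros s Hs. apply flow_in_disc; auto.
    - apply smooth_piece_flow; assumption. }
  split; [exact I1 |]. split; [exact I2 |].
  apply RInt_le; [lra | exact I1 | exact I2 |]. intros s Hs.
  destruct Hp as [g [_ Hder]].
  assert (Hds : unit_disc (gamma s)) by (apply Hd; lra).
  assert (D := derive_along_curve (flow c q) gamma s _ _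
     (flow_derive_z c q _ (radicand_Re_pos c q _ Hc Hq' Hds)) (Hder s Hs)).
  unfold G, H. rewrite (velocity_derive (fun r : R => flow c q (gamma r)) _ _ D).
  rewrite (velocity_derive _ _ _ (Hder s Hs)).
  fold (flow_deriv c q (gamma s)). rewrite Cmult_comm.
  (* The flow at q = 1 is the identity. *)
  assert (K := F_K_flow_contracts c 1 q (gamma s) (g s) Hc (proj1 Hq) (proj2 Hq) (Rle_refl 1) Hds).
  rewrite flow_at_1, flow_deriv_at_1, Cmult_1_l, Rdiv_1_r in K. exact K. }
destruct T as (_ & I2 & T).
unfold K_length. fold G H. rewrite <- H0, <- H1.
apply Rle_trans with (1 := T). apply Req_le.
apply (RInt_scal (V := R_CompleteNormedModule) H).
assert (Hqi : forall s, H s = scal (/ q) (q * H s)).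
{ intros s. unfold scal; simpl; unfold mult; simpl. field. lra. }
apply ex_RInt_ext with (fun s => scal (/ q) (q * H s)); [intros s _; symmetry; apply Hqi |].
apply (ex_RInt_scal (V := R_NormedModule) (fun s => q * H s)), I2.
Qed.

Lemma segment_in_disc (x y : C) : unit_disc x -> unit_disc y ->
  curve_in_disc x y (fun s => x + RtoC s * (y - x))%C.
Proof.
intros Hx Hy.
assert (D : forall s, is_curve_derive
   (fun s => x + RtoC s * (y - x))%C s (y - x)%C).
{ intros s. apply curve_derive_iff. intros eps. exists (mkposreal 1 Rlt_0_1). intros u _.
  replace (x + RtoC u * (y - x) - (x + RtoC s * (y - x)) - RtoC (u - s) * (y - x))%C with (RtoC 0)
    by (rewrite RtoC_minus; ring).
  rewrite Cmod_0. apply Rmult_le_pos; [apply Rlt_le, cond_pos | apply Rabs_pos]. }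
split; [split |].
- apply continuous_on_forall. intros s _.
  apply (ex_derive_continuous (K := R_AbsRing) (V := C_R_NormedModule)). exists (y - x)%C. apply D.
- exists 1%nat, INR. split; [reflexivity |]. split; [reflexivity |]. split.
  + intros i _. rewrite S_INR. lra.
  + intros i _. exists (fun _ => y - x)%C. split.
    * apply continuous_on_forall. intros s _. apply continuous_const.
    * intros s _. apply D.
- split; [| split; ring].
  intros s Hs. unfold unit_disc in *.
  replace (x + RtoC s * (y - x))%C with (RtoC (1 - s) * x + RtoC s * y)%C
    by (rewrite RtoC_minus; ring).
  apply Rle_lt_trans with (1 := Cmod_triangle _ _).
  rewrite !Cmod_mult, !Cmod_R, !Rabs_pos_eq by lra.
  destruct (Req_dec s 0) as [-> | N]; [lra |]. nra.
Qed.

Lemma d_K_le (x y : C) (gamma : R -> C) : curve_in_disc x y gamma -> d_K x y <= K_length gamma.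
Proof.
intros Hg. unfold d_K. set (E := fun L => _). 
destruct (Glb_Rbar_correct E) as [Lb Gr].
assert (P : Rbar_le 0 (Glb_Rbar E)).
{ apply Gr. intros L [g [Hc ->]]. exact (K_length_ge0 _ _ _ Hc). }
assert (Q := Lb (K_length gamma) (ex_intro _ gamma (conj Hg eq_refl))).
destruct (Glb_Rbar E); simpl in *; try contradiction; assumption.
Qed.

(** Segments show that the set of lengths is not empty; otherwise its infimum would
be infinite and its real part 0. *)
Lemma d_K_ge (x y : C) (m : R) : unit_disc x -> unit_disc y ->
  (forall gamma, curve_in_disc x y gamma -> m <= K_length gamma) -> m <= d_K x y.
Proof.
intros Hx Hy H. unfold d_K. set (E := fun L => _).
destruct (Glb_Rbar_correct E) as [Lb Gr].
assert (P : Rbar_le m (Glb_Rbar E)).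
{ apply Gr. intros L [g [Hc ->]]. exact (H _ Hc). }
assert (Q := Lb _ (ex_intro _ _ (conj (segment_in_disc x y Hx Hy) eq_refl))).
destruct (Glb_Rbar E); simpl in *; try contradiction; assumption.
Qed.

Lemma d_K_flow (c q : R) (x y : C) : 0 <= c <= 2 / 3 -> 0 < q <= 1 -> unit_disc x -> unit_disc y ->
  d_K (flow c q x) (flow c q y) <= q * d_K x y.
Proof.
intros Hc Hq Hx Hy. rewrite Rmult_comm. apply Rle_div_l; [lra |].
apply d_K_ge; [exact Hx | exact Hy |]. intros gamma Hg.
apply Rle_div_l; [lra |]. rewrite Rmult_comm.
apply Rle_trans with (2 := K_length_flow c q x y gamma Hc Hq Hg).
apply d_K_le. apply flow_curve; [exact Hc | lra | exact Hg].
Qed.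

Theorem corollary1 :
  forall (a c : R), 0 < a -> 0 <= c <= 2 / 3 ->
  forall phi : R -> C -> C, is_semiflow (f_c a c) phi ->
    (intrinsically_contracting phi a /\
     (forall lambda : R, intrinsically_contracting phi lambda -> lambda <= a)) /\
    (forall (x y : C) (t : R), unit_disc x -> unit_disc y -> 0 <= t ->
       d_K (phi t x) (phi t y) <= exp (- a * t) * d_K x y).
Proof.
intros a c Ha Hc phi Hphi. split; [split |].
- apply semiflow_intrinsically_contracting with c; assumption.
- intros lambda. apply contraction_rate_le with c; assumption.
- intros x y t Hx Hy Ht. rewrite !(semiflow_explicit a c phi) by assumption.
  apply d_K_flow; try assumption. apply exp_decay; assumption.
Qed.
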